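(* Assume the Axiom of Choice. Let $X=(X,d)$ be an uncountable ultrametric Polish space. Then there is a map $\psi\colon\mathscr P(\omega)\to\mathscr P(X)$ such that for all $a,b\subseteq\omega$: (1) if $a\subseteq b$ then $\psi(a)\le_{\mathsf L(d)}\psi(b)$; (2) if $\psi(a)\le_{\mathsf{Bor}(X)}\psi(b)$ then $a\subseteq b$. In particular, $(\mathscr P(\omega),\subseteq)$ embeds into the $\mathcal F$-hierarchy on $X$ for every reducibility $\mathcal F$ with $\mathsf L(d)\subseteq\mathcal F\subseteq\mathsf{Bor}(X)$, and hence the $\mathcal F$-hierarchy on all subsets of $X$ is very bad.
   Context: An ultrametric Polish space is a separable metric space $(X,d)$ with $d$ a complete ultrametric. $\mathsf L(d)$: maps $f\colon X\to X$ with $d(f(x),f(y))\le d(x,y)$; $\mathsf{Bor}(X)$: Borel measurable maps $X\to X$. A reducibility is a set of self-maps of $X$ closed under composition containing the identity; $A\le_{\mathcal F}B$ iff $A=f^{-1}(B)$ for some $f\in\mathcal F$. The $\mathcal F$-hierarchy is the quotient of $(\mathscr P(X),\le_{\mathcal F})$ by the induced equivalence; it is very bad if it contains both an infinite antichain and an infinite strictly descending chain. *)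

(* Defs.v *)
From HB Require Import structures.
From mathcomp Require Import all_boot all_order all_algebra.
From mathcomp Require Import all_classical all_reals all_analysis.
From mathcomp Require Import metric_structure.

Set Implicit Arguments.
Unset Strict Implicit.
Unset Printing Implicit Defensive.

Import Order.TTheory GRing.Theory Num.Theory.

Local Open Scope classical_set_scope.
Local Open Scope ring_scope.

(* The library's complete spaces are pointed by construction, hence these
   unbundled predicates on a metricType. *)
Definition seq_complete (R : realType) (X : metricType R) : Prop :=
  forall u : nat -> X, cauchy (u @ \oo) -> exists l : X, u @ \oo --> l.

Definition separable (X : topologicalType) : Prop :=
  exists2 D : set X, countable D & dense D.

Definition ultrametric (R : realType) (X : metricType R) : Prop :=
  forall x y z : X, mdist x z <= Num.max (mdist x y) (mdist y z).

Definition ultrametric_polish (R : realType) (X : metricType R) : Prop :=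
  [/\ separable X, seq_complete X & ultrametric X].

Definition Lip (R : realType) (X : metricType R) : set (X -> X) :=
  [set f | forall x y, mdist (f x) (f y) <= mdist x y].

(* [measurable_fun] needs a pointed space; this is what it unfolds to for the
   sigma-algebra generated by the open sets. *)
Definition Bor (X : topologicalType) : set (X -> X) :=
  [set f | forall B : set X, <<s @open X >> B -> <<s @open X >> (f @^-1` B)].

Section Reducibilities.
Variables (X : Type) (F : set (X -> X)).

Definition reducibility : Prop :=
  F id /\ forall f g, F f -> F g -> F (g \o f).

Definition reducible (A B : set X) : Prop :=
  exists2 f, F f & A = f @^-1` B.

Definition degree (A : set X) : set (set X) :=
  [set B | reducible A B /\ reducible B A].

Definition hierarchy : set (set (set X)) := range degree.

Definition degree_le (c c' : set (set X)) : Prop :=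
  exists A B, [/\ c A, c' B & reducible A B].

Definition has_infinite_antichain : Prop :=
  exists S : set (set (set X)),
    [/\ S `<=` hierarchy, infinite_set S &
        forall c c', S c -> S c' -> c <> c' -> ~ degree_le c c'].

Definition has_infinite_descending_chain : Prop :=
  exists s : nat -> set (set X),
    (forall n, hierarchy (s n)) /\
    (forall n, degree_le (s n.+1) (s n) /\ ~ degree_le (s n) (s n.+1)).

Definition very_bad : Prop :=
  has_infinite_antichain /\ has_infinite_descending_chain.

Definition powerset_omega_embeds : Prop :=
  exists g : set nat -> set (set X),
    (forall a, hierarchy (g a)) /\
    (forall a b, a `<=` b <-> degree_le (g a) (g b)).

End Reducibilities.

(* Main.v *)
(* Around a condensation point [z] there are infinitely many uncountable spheres
   [U_n] with centre [z]; each contains a copy of the Cantor space, of which we keep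
   a part [V_n] of size continuum, and a point [c_n] outside [V_n].  For a set [A] to
   be chosen, [psi b] is the part of [A] lying in the [V_m] with [m] in [b].  If [a]
   is included in [b], collapsing every [U_n] with [n] outside [a] to [c_n] is a
   nonexpansive reduction, because a point off a sphere is equidistant from all
   points of the sphere.

   There are at most continuum many Borel functions, since a Borel set is described by
   a countably branching well-founded tree.  So [A] can be built by recursion along
   a well-order of type continuum, defeating one pair [(f, n)] at each stage: fewer
   than continuum many points are decided so far, so either some undecided point [x]
   of [V_n] has [f x] not yet in [A], and we put [x] in and keep [f x] out (or
   [f x] is in [V_n], which is harmless), or two undecided points of [V_n] have the same
   image and exactly one of them is put in. *)

Require Import Defs.
From mathcomp Require Import all_boot all_order all_algebra.
From mathcomp Require Import all_classical all_reals all_analysis.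
From mathcomp Require Import metric_structure wochoice.

Set Implicit Arguments.
Unset Strict Implicit.
Unset Printing Implicit Defensive.

Import Order.TTheory GRing.Theory Num.Theory.

Local Open Scope classical_set_scope.

(** * A diagonal set *)

Section WellOrderedIndices.
Variable J : choiceType.
Implicit Types (lt : J -> J -> Prop) (j k : J).

(** With choice, this says that the segment below [j] has fewer elements than [J]; failure to
    surject replaces any cardinal arithmetic. *)
Definition small_segment lt j : Prop :=
  forall t : J -> J, exists z, forall k, lt k j -> t k <> z.

Lemma exists_well_founded_total : exists2 lt : J -> J -> Prop,
  well_founded lt & forall j k, [\/ lt j k, j = k | lt k j].
Proof.
have [r wor] := well_ordering_principle J.
have rwo : wo_chain r predT by move=> A _; exact: wor.
have asym x y : r x y -> r y x -> x = y.
  by move=> xy yx; apply: (wo_chain_antisymmetric rwo) => //; rewrite xy yx.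
have tot x y : r x y || r y x by apply: (wo_chainW rwo).
exists (fun k j => k <> j /\ r k j); last first.
  move=> j k; have [->|/eqP jk] := eqVneq j k; first by constructor 2.
  have /orP[jk'|kj] := tot j k; first by constructor 1.
  by constructor 3; split=> // /esym.
apply: contrapT => /existsNP[x nx].
have [|z [[/asboolP nz zmin] _]] :=
    wor [pred z | `[< ~ Acc (fun k j => k <> j /\ r k j) z >]].
  by exists x; apply/asboolP.
apply: nz; constructor => k [kz rkz]; apply: contrapT => nk.
by apply/kz/asym => //; apply: zmin; apply/asboolP.
Qed.

(* When some segment of [J] already surjects onto [J], cutting the order at the
   least such segment leaves an index set of the least order type that still
   enumerates [J]. *)
Lemma small_segment_enumeration lt : well_founded lt ->
  exists s : J -> J, forall z, exists2 j, small_segment lt j & s j = z.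
Proof.
move=> wf; have [allsmall|] := pselect (forall j, small_segment lt j).
  by exists id => z; exists z.
move=> /existsNP[j]; elim/(well_founded_ind wf): j => j IH nj.
have [[k kj nk]|none] := pselect (exists2 k, lt k j & ~ small_segment lt k).
  exact: IH kj nk.
move/existsNP: nj => [t /forallNP tj]; exists t => z.
have /existsNP[k /not_implyP[kj /contrapT tk]] := tj z.
by exists k => //; apply: contrapT => nk; apply: none; exists k.
Qed.

(** Transfinite recursion by choice: each stage picks a good value given the set of earlier values.
    Existence is asked stage by stage, so a stage without a good value takes the default [y0] and
    does no harm. *)
Lemma well_founded_choice (Y : choiceType) (y0 : Y) lt
    (good : J -> set Y -> Y -> Prop) : well_founded lt ->
  exists s : J -> Y, forall j,
    (exists y, good j [set s k | k in [set k | lt k j]] y) ->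
    good j [set s k | k in [set k | lt k j]] (s j).
Proof.
move=> wf.
pose step j (rec : forall k, lt k j -> Y) :=
  xget y0 (good j [set y | exists k (kj : lt k j), rec k kj = y]).
pose s := Fix wf (fun _ => Y) step.
exists s => j exy.
suff -> : s j = xget y0 (good j [set s k | k in [set k | lt k j]]).
  exact: xgetPex.
rewrite /s Fix_eq.
  rewrite /step; congr (xget y0 (good j _)).
  apply/seteqP; split=> y /=; first by move=> [k [kj <-]]; exists k.
  by move=> [k kj <-]; exists k, kj.
move=> i f g fg; congr (step i _).
by apply/functional_extensionality_dep => k; apply/functional_extensionality_dep.
Qed.

End WellOrderedIndices.

Section Diagonalization.
Variables (J X : choiceType) (h : nat -> J * J * J -> X).
Variable task : J -> (X -> X) * nat.
Hypothesis h_inj : forall n, injective (h n).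
Hypothesis h_disj : forall m n p q, h m p = h n q -> m = n.

(* A cover of [J * J * J] by three images of a segment would make one of the
   coordinates of the corresponding image exhaust [J]. *)
Lemma small_segment_avoid (lt : J -> J -> Prop) j (n : nat) (f g k : J -> X) :
  small_segment lt j ->
  exists2 v, range (h n) v &
    forall i, lt i j -> [/\ f i <> v, g i <> v & k i <> v].
Proof.
move=> sj; pose inv x := xget (j, j, j) [set p | h n p = x].
have invK p : inv (h n p) = p.
  by apply: xget_unique => // q; exact: h_inj.
have [z1 z1P] := sj (fun i => (inv (f i)).1.1).
have [z2 z2P] := sj (fun i => (inv (g i)).1.2).
have [z3 z3P] := sj (fun i => (inv (k i)).2).
exists (h n (z1, z2, z3)); first by exists (z1, z2, z3).
by move=> i ij; split=> ev; [apply: (z1P i ij)|apply: (z2P i ij)|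
  apply: (z3P i ij)]; rewrite ev invK.
Qed.

(* [q = (x, y)] with [x] put into the set under construction and [y], if any,
   kept out of it; [H] collects the earlier decisions. *)
Definition diag_step (fn : (X -> X) * nat) (H : set (X * option X))
    (q : X * option X) : Prop :=
  [/\ range (h fn.2) q.1,
      forall p, H p -> p.2 <> Some q.1,
      forall p, H p -> q.2 <> Some p.1,
      q.2 <> Some q.1 &
      [\/ q.2 = Some (fn.1 q.1), range (h fn.2) (fn.1 q.1) |
          exists w, [/\ q.2 = Some w, range (h fn.2) w & fn.1 w = fn.1 q.1]]].

Lemma diag_step_exists (lt : J -> J -> Prop) j fn (s : J -> X * option X) :
  small_segment lt j ->
  exists q, diag_step fn [set s k | k in [set k | lt k j]] q.
Proof.
case: fn => f n sj.
(* [D k] was put in at stage [k] and [E k] kept out, with [D k] as a dummy if nothing was; [W] holds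
   the undecided points. *)
pose D k := (s k).1; pose E k := odflt (D k) (s k).2.
pose W := [set v | range (h n) v /\ forall k, lt k j -> D k <> v /\ E k <> v].
(* Since [v] will also avoid every [g k], a bad image [f v = D k] gives a second undecided point
   [g k] with the same image. *)
pose g k := xget (D k) [set v | W v /\ f v = D k].
have [v Vv vP] := small_segment_avoid n D E g sj.
have Wv : W v by split=> // k /vP[].
have outv w : W w -> forall k, lt k j -> (s k).2 <> Some w.
  by move=> [_ Ww] k /Ww[_]; rewrite /E; case: (s k).2 => // y /= yw [].
have [[k kj fv]|fvD] := pselect (exists2 k, lt k j & f v = D k).
  have [Wg fg] : [set v | W v /\ f v = D k] (g k) by apply: xgetPex; exists v.
  exists (v, Some (g k)); split=> //=.
  - by move=> _ [i ij <-]; exact: outv.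
  - by move=> _ [i ij <-] [eg]; have [] := Wg.2 i ij; rewrite eg.
  - by move=> [gv]; have [_ _] := vP k kj.
  - by constructor 3; exists (g k); split=> //; [case: Wg|rewrite fg].
have [fvv|fvv] := pselect (f v = v).
  exists (v, None); split=> //=.
    by move=> _ [i ij <-]; exact: outv.
  by constructor 2; rewrite fvv.
exists (v, Some (f v)); split=> //=.
- by move=> _ [i ij <-]; exact: outv.
- by move=> _ [i ij <-] [fvi]; apply: fvD; exists i.
- by move=> [].
- by constructor 1.
Qed.

Lemma diagonal_set : exists A : set X, forall j (b : set nat),
  ~ b (task j).2 ->
  ~ (forall x, range (h (task j).2) x ->
       A x <-> A ((task j).1 x) /\ exists2 m, b m & range (h m) ((task j).1 x)).
Proof.
have [[j0]|noJ] := pselect (exists j : J, True); last first.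
  by exists set0 => j; case: noJ; exists j.
move=> _; have [lt wf tot] := exists_well_founded_total J.
have [e eP] := small_segment_enumeration wf.
have [s sP] := well_founded_choice (h 0%N (j0, j0, j0), None)
  (fun j => diag_step (task (e j))) wf.
have {}sP j : small_segment lt j ->
    diag_step (task (e j)) [set s k | k in [set k | lt k j]] (s j).
  by move=> /diag_step_exists ex; apply: sP.
(* Only small stages count; by [eP] they still handle every task. *)
pose A := [set x | exists2 j, small_segment lt j & (s j).1 = x].
have outA j y : small_segment lt j -> (s j).2 = Some y -> ~ A y.
  move=> sj sjy [k sk sky]; rewrite -sky in sjy.
  have [_ _ jnew jj _] := sP j sj; have [_ kold _ _ _] := sP k sk.
  (* Whichever stage comes later respects the decision of the earlier one. *)
  have [jk|jk|kj] := tot j k.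
  - by apply: (kold (s j)) => //; exists j.
  - by rewrite jk in sjy jj.
  - by apply: (jnew (s k)) => //; exists k.
exists A => z b nb red; have [j sj ejz] := eP z.
have [Vx _ _ _ cases] := sP j sj; rewrite ejz in Vx cases.
have Ax : A (s j).1 by exists j.
have [/(_ Ax)[Afx [m bm Vm]] _] := red _ Vx.
(* The image was kept out of [A]; or it lies in the piece of index [n], forcing [n] into [b]; or [w]
   has the same image, so the reduction puts it in [A] although it was kept out. *)
case: cases => [yfx|Vfx|[w [yw Vw fw]]].
- exact: outA yfx Afx.
- by case: Vfx Vm => p _ <- [q _ /h_disj mn]; apply: nb; rewrite -mn.
- by apply: (outA j w sj yw); apply/(red _ Vw); rewrite fw; split=> //; exists m.
Qed.

End Diagonalization.

(** * Counting Borel functions *)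

Section BorelCodes.

Inductive borel_code : Type :=
  | BBase of nat
  | BNode of (nat -> borel_code).

(** The leaf labels, as a partial function on finite paths, determine the tree: countably much
    data. *)
Fixpoint code_path (t : borel_code) (p : seq nat) : option nat :=
  match t, p with
  | BBase n, [::] => Some n
  | BNode f, i :: q => code_path (f i) q
  | _, _ => None
  end.

Lemma code_path_inj : injective code_path.
Proof.
elim=> [n|f IH] [m|g] // E.
- by have := congr1 (@^~ [::]) E => -[->].
- by have := congr1 (@^~ [::]) E.
- by have := congr1 (@^~ [::]) E.
- congr BNode; apply/funext => i; apply: IH; apply/funext => p.
  exact: (congr1 (@^~ (i :: p)) E).
Qed.

Variables (X : Type) (B : nat -> set X).

(** Complemented unions suffice: a constant family yields complements, and a second node then yields
    unions. *)
Fixpoint code_set (t : borel_code) : set X :=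
  match t with
  | BBase n => B n
  | BNode f => ~` \bigcup_i code_set (f i)
  end.

Lemma code_setC t : code_set (BNode (fun _ => t)) = ~` code_set t.
Proof. by rewrite /= bigcup_const. Qed.

Lemma code_setU (f : nat -> borel_code) :
  code_set (BNode (fun _ => BNode f)) = \bigcup_i code_set (f i).
Proof. by rewrite code_setC /= setCK. Qed.

Lemma range_code_set_sigma_algebra : sigma_algebra setT (range code_set).
Proof.
split.
- exists (BNode (fun i => if i is 0%N then BBase 0 else BNode (fun _ => BBase 0))) => //=.
  rewrite -subset0 => x; apply; have [Bx|nBx] := pselect (B 0%N x).
    by exists 0%N.
  by exists 1%N => //=; rewrite bigcup_const.
- by move=> _ [t _ <-]; exists (BNode (fun _ => t)) => //; rewrite code_setC setTD.
- move=> F /(_ _)/cid2-/all_sig[f fP].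
  exists (BNode (fun _ => BNode f)) => //; rewrite code_setU.
  by apply: eq_bigcupr => i _; have [] := fP i.
Qed.

End BorelCodes.

Lemma borel_code_set (X : topologicalType) (B : nat -> set X) :
  (forall U, open U -> exists S : set nat, U = \bigcup_(i in S) B i) ->
  <<s @open X >> `<=` range (code_set B).
Proof.
move=> base; apply: smallest_sub; first exact: range_code_set_sigma_algebra.
have [S0 SC SU] := range_code_set_sigma_algebra B.
move=> U /base[S ->]; rewrite bigcup_mkcond; apply: SU => i.
by case: ifP => // _; exists (BBase i).
Qed.

(** Characteristic function of a graph: index [0] stores the number, index [k'.+1] the path function
    of the code [cn.1 k']. *)
Definition encode_codes (cn : (nat -> borel_code) * nat) (N : nat) : bool :=
  if unpickle N is Some (k, p, m) then
    (if k is k'.+1 then code_path (cn.1 k') p else Some cn.2) == Some m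
  else false.

Lemma encode_codes_inj : injective encode_codes.
Proof.
move=> [c n] [d m] E.
have {}E k p i : ((if k is k'.+1 then code_path (c k') p else Some n) == Some i)
    = ((if k is k'.+1 then code_path (d k') p else Some m) == Some i).
  by have := congr1 (@^~ (pickle (k, p, i))) E; rewrite /encode_codes pickleK.
congr (_, _); last first.
  by have := E 0%N [::] n; rewrite eqxx => /esym/eqP[].
apply/funext => k; apply: code_path_inj; apply/funext => p.
have := E k.+1 p; case: (code_path (c k) p) => [i|].
  by move=> /(_ i); rewrite eqxx => /esym/eqP.
case: (code_path (d k) p) => [i|//].
by move=> /(_ i); rewrite eqxx.
Qed.

(** The [B k] separate points, so [f] is recovered from their preimages; each has a code, and one
    bit sequence carries all these codes together with [n]. *)
Lemma Bor_enumeration (X : topologicalType) (B : nat -> set X) :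
  (forall n, open (B n)) ->
  (forall U, open U -> exists S : set nat, U = \bigcup_(i in S) B i) ->
  (forall x y, (forall n, B n x -> B n y) -> x = y) ->
  exists task : (nat -> bool) -> (X -> X) * nat,
    forall f n, Bor f -> exists j, task j = (f, n).
Proof.
move=> Bo base sep.
pose codes (c : nat -> borel_code) (f : X -> X) :=
  forall k, code_set B (c k) = f @^-1` B k.
exists (fun j => xget (@id X, 0%N)
  [set fn | exists2 c, codes c fn.1 & encode_codes (c, fn.2) = j]) => f n fB.
have /(_ _)/cid2-/all_sig[c cP] : forall k,
    range (code_set B) (f @^-1` B k).
  by move=> k; apply: (borel_code_set base); apply: fB; exact: sub_sigma_algebra.
exists (encode_codes (c, n)); apply: xget_unique => /=.
  by exists c => // k; have [] := cP k.
move=> [g m] [d /= dP /encode_codes_inj[dc ->]]; congr (_, _).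
apply/funext => x; apply: sep => k; have [_] := cP k; rewrite -dc dP => gf.
by move=> ?; have : (g @^-1` B k) x by []; rewrite gf.
Qed.

Local Open Scope ring_scope.

(** * Uncountable separable ultrametric spaces *)

Lemma natSinv_lt (R : realType) (r : R) : 0 < r -> exists n, n.+1%:R^-1 < r.
Proof.
move=> r0; have [N _ /(_ N)/(_ (leqnn _)) Nr] := near_infty_natSinv_lt (PosNum r0).
by exists N.
Qed.

Section DenseSequence.
Variables (R : realType) (X : metricType R).
Implicit Types (x y z : X) (S : set X).

Lemma open_mball x (r : R) : open [set y | mdist x y < r].
Proof.
rewrite openE => y /= xy; rewrite /interior -nbhs_ballE /=.
exists (r - mdist x y); first by rewrite /= subr_gt0.
rewrite ballEmdist => z /= yz.
by apply: le_lt_trans (metric_triangle x y z) _; rewrite -ltrBrDl.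
Qed.

Lemma separable_dense_sequence : separable X -> (exists x : X, True) ->
  exists e : nat -> X, forall x (r : R), 0 < r -> exists i, mdist x (e i) < r.
Proof.
move=> [D /countable_injP[f finj] dD] [x0 _].
exists (fun i => xget x0 [set x | D x /\ f x = i]) => x r r0.
have [|y [/= xy Dy]] := dD _ _ (open_mball x r).
  by exists x => /=; rewrite mdistxx.
exists (f y); rewrite (@xget_unique _ x0 _ y) // => z [Dz fzy].
by apply: finj => //; rewrite inE.
Qed.

Variable e : nat -> X.
Hypothesis e_dense : forall x (r : R), 0 < r -> exists i, mdist x (e i) < r.

Definition basic_ball (n : nat) : set X :=
  if unpickle n is Some ik then
    [set y | mdist (e (ik : nat * nat).1) y < ik.2.+1%:R^-1] else set0.

Lemma open_basic_ball n : open (basic_ball n).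
Proof.
rewrite /basic_ball; case: unpickle => [ik|]; first exact: open_mball.
exact: open0.
Qed.

Lemma basic_ball_sub x (r : R) : 0 < r ->
  exists2 n, basic_ball n x & basic_ball n `<=` [set y | mdist x y < r].
Proof.
move=> r0; have [k kr] := natSinv_lt (divr_gt0 r0 (ltr0Sn R 1)).
have [|i xi] := e_dense x (r := k.+1%:R^-1); first by rewrite invr_gt0 ltr0Sn.
exists (pickle (i, k)); rewrite /basic_ball pickleK /=; first by rewrite metric_sym.
move=> y /= iy; apply: le_lt_trans (metric_triangle x (e i) y) _.
by rewrite (splitr r) ltrD // (lt_trans _ kr).
Qed.

Lemma basic_ball_base (U : set X) : open U ->
  exists S : set nat, U = \bigcup_(i in S) basic_ball i.
Proof.
rewrite openE => Uo; exists [set i | basic_ball i `<=` U].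
apply/seteqP; split=> [x Ux|x [i /= iU ix]]; last exact: iU.
have := Uo x Ux; rewrite /interior -nbhs_ballE => -[r /= r0].
rewrite ballEmdist => rU; have [n nx nr] := basic_ball_sub x r0.
by exists n => //=; exact: subset_trans nr rU.
Qed.

Lemma basic_ball_separates x y :
  (forall n, basic_ball n x -> basic_ball n y) -> x = y.
Proof.
move=> xy; apply/eqP/negPn/negP => nxy.
have [|n nx nsub] := basic_ball_sub x (r := mdist x y); first by rewrite mdist_gt0.
by have /nsub /= := xy n nx; rewrite ltxx.
Qed.

(** Each such point lies in one of the countably many basic balls whose trace on [S] is
    countable. *)
Lemma countable_non_condensation S : countable
  [set x | S x /\ exists2 r : R, 0 < r & countable (S `&` [set y | mdist x y < r])].
Proof.
apply: (@sub_countable _ _ _ (\bigcup_(n in [set n |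
    countable (S `&` basic_ball n)]) (S `&` basic_ball n))); last first.
  by apply: bigcup_countable => // n.
apply: subset_card_le => x [Sx [r r0 cr]].
have [n nx nr] := basic_ball_sub x r0.
exists n => //=; apply: sub_countable cr.
by apply: subset_card_le; exact: setIS.
Qed.

Lemma condensation_pair S : ~ countable S -> exists x y, [/\ S x, S y, x != y,
  forall r : R, 0 < r -> ~ countable (S `&` [set z | mdist x z < r]) &
  forall r : R, 0 < r -> ~ countable (S `&` [set z | mdist y z < r])].
Proof.
move=> uS; pose N := [set x | S x /\
  exists2 r : R, 0 < r & countable (S `&` [set y | mdist x y < r])].
have cN : countable N := countable_non_condensation S.
have notN x : S x -> ~ N x ->
    forall r : R, 0 < r -> ~ countable (S `&` [set z | mdist x z < r]).
  by move=> Sx Nx r r0 cr; apply: Nx; split=> //; exists r.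
have more (C : set X) : countable C -> exists2 x, S x & ~ C x.
  move=> cC; apply: contrapT => none; apply: uS; apply: sub_countable cC.
  apply: subset_card_le => x Sx; apply: contrapT => Cx.
  by apply: none; exists x.
have [x Sx Nx] := more N cN.
have [|y Sy] := more (\bigcup_(b : bool) (if b then N else [set x])).
  by apply: bigcup_countable => // -[].
move=> NUy; exists x, y; split=> //; last 2 first.
- exact: notN.
- by apply: notN => // Ny; apply: NUy; exists true.
by apply/eqP => xy; apply: NUy; exists false.
Qed.

End DenseSequence.

(** * Cantor schemes and uncountable spheres in ultrametric spaces *)

Section Ultrametric.
Variables (R : realType) (X : metricType R).
Hypothesis ultra : ultrametric X.
Implicit Types (x y z : X) (S : set X).

Lemma ultra_lt x y z (r : R) : mdist x y < r -> mdist y z < r -> mdist x z < r.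
Proof.
by move=> xy yz; apply: le_lt_trans (ultra x y z) _; rewrite gt_max xy yz.
Qed.

Lemma ultra_isosceles x y z : mdist z x < mdist z y -> mdist x y = mdist z y.
Proof.
move=> zxy; apply/le_anti/andP; split.
  by apply: le_trans (ultra x z y) _; rewrite ge_max lexx metric_sym ltW.
have := ultra z x y; rewrite le_max => /orP[|//].
by rewrite leNgt zxy.
Qed.

Definition metric_closed S : Prop :=
  forall x, (forall r : R, 0 < r -> exists2 y, S y & mdist x y < r) -> S x.

Lemma metric_closed_sphere z (r : R) : 0 < r ->
  metric_closed [set x | mdist z x = r].
Proof.
move=> r0 x /(_ r r0)[y /= zy xy]; rewrite -zy in xy *.
apply: le_anti; apply/andP; split.
  by apply: le_trans (ultra z y x) _; rewrite ge_max lexx metric_sym ltW.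
have := ultra z x y; rewrite le_max => /orP[//|].
by rewrite leNgt xy.
Qed.

Lemma metric_closedI_ball S z (r : R) : 0 < r -> metric_closed S ->
  metric_closed (S `&` [set x | mdist z x < r]).
Proof.
move=> r0 cS x xP; split.
  by apply: cS => e e0; have [y [Sy _] xy] := xP e e0; exists y.
by have [y [_ /= zy] xy] := xP r r0; apply: ultra_lt zy _; rewrite metric_sym.
Qed.

Variable e : nat -> X.
Hypothesis e_dense : forall x (r : R), 0 < r -> exists i, mdist x (e i) < r.

Lemma uncountable_split S (d : R) : 0 < d -> metric_closed S -> ~ countable S ->
  exists T : bool -> set X,
    (forall b, [/\ metric_closed (T b), ~ countable (T b), T b `<=` S &
      forall x y, T b x -> T b y -> mdist x y < d]) /\
    (forall x b c, T b x -> T c x -> b = c).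
Proof.
move=> d0 cS uS; have [x [y [Sx Sy xy cx cy]]] := condensation_pair e_dense uS.
(* The bound [d] controls the diameter, which in an ultrametric does not exceed the radius; the
   bound [mdist x y] makes the two balls disjoint. *)
pose r := Num.min d (mdist x y).
have r0 : 0 < r by rewrite lt_min d0 mdist_gt0.
pose p (b : bool) := if b then x else y.
have near b z w : mdist (p b) z < r -> mdist (p b) w < r -> mdist z w < r.
  by move=> bz bw; apply: ultra_lt bw; rewrite metric_sym.
have disj z : mdist x z < r -> mdist y z < r -> False.
  move=> xz yz; have : mdist x y < r by apply: ultra_lt xz _; rewrite metric_sym.
  by rewrite lt_min ltxx andbF.
exists (fun b => S `&` [set z | mdist (p b) z < r]); split.
  move=> b; split; first exact: metric_closedI_ball.
  - by case: b; [exact: cx|exact: cy].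
  - by move=> ? [].
  - move=> z w [_ /= bz] [_ /= bw]; have := near b z w bz bw.
    by rewrite lt_min => /andP[].
move=> z [] [] [_ /= bz] [_ /= cz] //; first by case: (disj z).
by case: (disj z).
Qed.

Lemma seq_complete_cauchy (u : nat -> X) : seq_complete X ->
  (forall k m n, (k < m)%N -> (k < n)%N -> mdist (u m) (u n) < k.+1%:R^-1) ->
  exists l, forall r : R, 0 < r ->
    exists N, forall n, (N <= n)%N -> mdist l (u n) < r.
Proof.
move=> complX uP; have [|l ul] := complX u.
  apply/cauchy_exP => r r0; have [k kr] := natSinv_lt r0.
  exists (u k.+1), k.+1 => // n /= kn; rewrite ballEmdist /=.
  by apply: lt_trans (uP k _ _ _ _) kr.
exists l => r r0.
have [N _ NP] := metricType_numDomainType.cvgr_dist_lt ul r0.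
by exists N => n Nn; exact: NP.
Qed.

(** A Cantor scheme: uncountable closed sets of shrinking diameter are split repeatedly into
    disjoint pairs, and each branch has a limit by completeness. *)
Lemma cantor_in_uncountable S : seq_complete X ->
  metric_closed S -> ~ countable S ->
  exists2 g : (nat -> bool) -> X, injective g & forall s, S (g s).
Proof.
move=> complX cS uS.
pose split_of (Sk : set X * nat) (T : bool -> set X) :=
  metric_closed Sk.1 -> ~ countable Sk.1 ->
  (forall b, [/\ metric_closed (T b), ~ countable (T b), T b `<=` Sk.1 &
      forall x y, T b x -> T b y -> mdist x y < Sk.2.+1%:R^-1]) /\
  (forall x b c, T b x -> T c x -> b = c).
have /choice[sp spP] : forall Sk, exists T, split_of Sk T.
  move=> [Q k]; have [[cQ uQ]|nQ] :=
      pselect (metric_closed Q /\ ~ countable Q); last first.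
    by exists (fun=> set0) => cQ uQ; case: nQ.
  have [|T TP] := uncountable_split (d := k.+1%:R^-1) _ cQ uQ.
    by rewrite invr_gt0 ltr0Sn.
  by exists T => _ _.
pose C (s : nat -> bool) := fix C k :=
  if k is k'.+1 then sp (C k', k') (s k') else S.
have CP s k : metric_closed (C s k) /\ ~ countable (C s k).
  elim: k => [//|k [cC uC]]; have [/(_ (s k))[? ? _ _] _] := spP (C s k, k) cC uC.
  by split.
have Csplit s k := spP (C s k, k) (CP s k).1 (CP s k).2.
have Cdec s m n : (m <= n)%N -> C s n `<=` C s m.
  elim: n => [|n IH]; first by rewrite leqn0 => /eqP ->.
  rewrite leq_eqVlt => /orP[/eqP -> //|/IH]; apply: subset_trans.
  by have [/(_ (s n))[]] := Csplit s n.
have pts s : exists u : nat -> X, forall k, C s k (u k).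
  suff ne : forall k, exists x, C s k x by have [u uP] := choice ne; exists u.
  move=> k; apply: contrapT => none; apply: (CP s k).2; suff -> : C s k = set0 by [].
  by rewrite -subset0 => x Cx; apply: none; exists x.
have /choice[g gP] : forall s, exists l, forall k, C s k l.
  move=> s; have [u uP] := pts s; have [|l lP] := seq_complete_cauchy (u := u) complX.
    move=> k m n km kn; have [/(_ (s k))[_ _ _ Cd] _] := Csplit s k; apply: Cd.
      exact: (Cdec s k.+1 m).
    exact: (Cdec s k.+1 n).
  exists l => k; apply: (CP s k).1 => r /lP[N NP].
  (* Index at least [k] to lie in [C s k], at least [N] to be close to [l]. *)
  exists (u (maxn N k)); first by apply: (Cdec s k (maxn N k)) => //; exact: leq_maxr.
  by apply: NP; exact: leq_maxl.
exists g; last by move=> s; exact: (gP s 0%N).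
move=> s t gst.
have eqC k : C s k = C t k /\ s k = t k.
  have step i : C s i = C t i -> s i = t i.
    move=> Ci; have [_ disj] := Csplit s i; apply: (disj (g s)).
      exact: (gP s i.+1).
    by rewrite gst Ci; exact: (gP t i.+1).
  elim: k => [|k [Ck sk]]; first by split=> //; exact: step.
  have Ck1 : C s k.+1 = C t k.+1 by rewrite /= Ck sk.
  by split=> //; exact: step.
by apply/funext => k; have [] := eqC k.
Qed.

(** By the isosceles property every nonzero distance from [z] is attained on the dense sequence, so
    a ball around [z] is a countable union of spheres and [{z}]. If [z] is a condensation point,
    some sphere of arbitrarily small radius is uncountable. *)
Lemma uncountable_spheres : ~ countable [set: X] -> exists (z : X) (r : nat -> R),
  [/\ injective r, forall n, 0 < r n &
      forall n, ~ countable [set x | mdist z x = r n]].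
Proof.
move=> uX; have [z [_ [_ _ _ cz _]]] := condensation_pair e_dense uX.
pose P (r : R) := 0 < r /\ ~ countable [set x | mdist z x = r].
have smaller d : 0 < d -> exists2 r, P r & r < d.
  move=> d0; apply: contrapT => none; apply: (cz d d0).
  pose G i := if i is i'.+1 then
    [set x | 0 < mdist z x < d /\ mdist z x = mdist z (e i')] else [set z].
  apply: (@sub_countable _ _ _ (\bigcup_i G i)).
    apply: subset_card_le => x [_ /= zx].
    have [->|nzx] := eqVneq x z; first by exists 0%N.
    have zx0 : 0 < mdist z x by rewrite mdist_gt0 eq_sym.
    have [i xi] := e_dense x zx0.
    exists i.+1 => //=; split; first by rewrite zx0.
    rewrite metric_sym (metric_sym z (e i)); apply/esym/ultra_isosceles.
    by rewrite (metric_sym x z).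
  apply: bigcup_countable => // -[|i] _; first exact: countable1.
  have [/andP[ei0 eid]|nei] := boolP (0 < mdist z (e i) < d).
    have [ci|ui] := pselect (countable [set x | mdist z x = mdist z (e i)]).
      by apply: sub_countable ci; apply: subset_card_le => x [].
    by case: none; exists (mdist z (e i)).
  suff -> : G i.+1 = set0 by [].
  by rewrite -subset0 => x [/= + xi]; rewrite xi (negPf nei).
have /choice[nx nxP] : forall d, exists r, 0 < d -> P r /\ r < d.
  move=> d; have [/smaller[r Pr rd]|] := boolP (0 < d); first by exists r.
  by exists 0.
(* The iteration starts at [n.+1] because [1] is only an upper bound, perhaps not a suitable
   radius. *)
pose r n := iter n.+1 nx 1.
have rP n : P (r n).
  elim: n => [|n IH]; first exact: (nxP 1 ltr01).1.
  exact: (nxP _ IH.1).1.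
have rS n : r n.+1 < r n by exact: (nxP _ (rP n).1).2.
have rdec m n : (m < n)%N -> r n < r m.
  elim: n => [//|n IH]; rewrite ltnS leq_eqVlt => /orP[/eqP ->|/IH].
    exact: rS.
  by apply: lt_trans; exact: rS.
exists z, r; split=> [m n mn|n|n]; last 2 first.
- exact: (rP n).1.
- exact: (rP n).2.
by case: (ltngtP m n) => // /rdec; rewrite mn ltxx.
Qed.

End Ultrametric.

(** * Embedding the subsets of [nat] *)

(* The three bit streams are interleaved in the positions after [0]; the leading
   [true] keeps the zero stream out of the range. *)
Definition interleave (p : (nat -> bool) * (nat -> bool) * (nat -> bool))
    (k : nat) : bool :=
  if k is k'.+1 then
    nth false [:: p.1.1 (k' %/ 3)%N; p.1.2 (k' %/ 3)%N; p.2 (k' %/ 3)%N] (k' %% 3)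
  else true.

Lemma interleave_inj : injective interleave.
Proof.
move=> [[a b] c] [[a' b'] c'] E.
have at_pos i k : (i < 3)%N -> nth false [:: a k; b k; c k] i =
    nth false [:: a' k; b' k; c' k] i.
  move=> i3; have := congr1 (@^~ (k * 3 + i)%N.+1) E.
  by rewrite /interleave /= divnMDl // divn_small // addn0 modnMDl modn_small.
congr (_, _, _); apply/funext => k.
- exact: (at_pos 0%N).
- exact: (at_pos 1%N).
- exact: (at_pos 2%N).
Qed.

(* Each sphere whose index lies outside [a] is collapsed to one of its own points;
   in an ultrametric space this does not increase any distance. *)
Lemma collapse_Lip (R : realType) (X : metricType R) (z : X) (r : nat -> R)
    (c : nat -> X) (a : set nat) : ultrametric X -> injective r ->
  (forall n, mdist z (c n) = r n) ->
  exists f : X -> X, [/\ Lip f,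
    forall n x, ~ a n -> mdist z x = r n -> f x = c n &
    forall x, (forall n, mdist z x = r n -> a n) -> f x = x].
Proof.
move=> ultra rinj cr.
have /choice[n_of n_ofP] : forall d, exists n, forall m, d = r m -> m = n.
  move=> d; have [[n dn]|none] := pselect (exists n, d = r n).
    by exists n => m; rewrite dn => /rinj.
  by exists 0%N => m dm; case: none; exists m.
pose f x := if `[< exists2 n, ~ a n & mdist z x = r n >]
  then c (n_of (mdist z x)) else x.
have fin n x : ~ a n -> mdist z x = r n -> f x = c n.
  move=> an zx; rewrite /f; case: asboolP => [_|[]]; last by exists n.
  by rewrite -(n_ofP _ _ zx).
have fout x : (forall n, mdist z x = r n -> a n) -> f x = x.
  by move=> xP; rewrite /f; case: asboolP => // -[n an /xP].
(* Hence points at different distances from [z] keep their mutual distance, while two at the same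
   distance both stay or both move to one point. *)
have fz x : mdist z (f x) = mdist z x.
  have [[n an zx]|none] := pselect (exists2 n, ~ a n & mdist z x = r n).
    by rewrite (fin n) // cr.
  rewrite fout // => n zx; apply: contrapT => an.
  by apply: none; exists n.
exists f; split=> // x y.
case: (ltgtP (mdist z x) (mdist z y)) => [lt|gt|xy].
- by rewrite (ultra_isosceles ultra lt) (@ultra_isosceles _ _ ultra _ _ z) fz // fz.
- rewrite (metric_sym x y) (metric_sym (f x) (f y)) (ultra_isosceles ultra gt).
  by rewrite (@ultra_isosceles _ _ ultra _ _ z) fz // fz.
- rewrite /f xy; case: asboolP => // _.
  by rewrite mdistxx mdist_ge0.
Qed.

Lemma exists_powerset_reduction (R : realType) (X : metricType R) :
  ultrametric_polish X -> ~ countable [set: X] ->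
  exists psi : set nat -> set X, forall a b : set nat,
    (a `<=` b -> reducible (@Lip R X) (psi a) (psi b)) /\
    (reducible (@Bor X) (psi a) (psi b) -> a `<=` b).
Proof.
move=> [sepX complX ultra] uncX.
have inhX : exists x : X, True.
  apply: contrapT => none; apply: uncX; suff -> : [set: X] = set0 by [].
  by rewrite -subset0 => x _; apply: none; exists x.
have [e e_dense] := separable_dense_sequence sepX inhX.
have [z [r [rinj r0 ru]]] := uncountable_spheres ultra e_dense uncX.
have /choice[g gP] : forall n, exists g : (nat -> bool) -> X,
    injective g /\ forall s, mdist z (g s) = r n.
  move=> n; have [g ginj gS] := cantor_in_uncountable ultra e_dense complX
    (metric_closed_sphere ultra (z := z) (r0 n)) (ru n).
  by exists g.
pose h n p := g n (interleave p).
pose c n := g n (fun=> false).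
have hz n x : range (h n) x -> mdist z x = r n.
  by move=> [p _ <-]; exact: (gP n).2.
have cz n : mdist z (c n) = r n by exact: (gP n).2.
have h_inj n : injective (h n).
  by move=> p q /(gP n).1; exact: interleave_inj.
have h_disj m n p q : h m p = h n q -> m = n.
  by move=> hpq; apply: rinj; rewrite -(hz m (h m p)) ?hpq ?(hz n) //; exists p || exists q.
have hc n : ~ range (h n) (c n).
  by move=> [p _ /(gP n).1 /(congr1 (@^~ 0%N))].
have [task taskP] := Bor_enumeration (@open_basic_ball _ _ e)
  (basic_ball_base e_dense) (basic_ball_separates e_dense).
have [A AP] := diagonal_set task h_inj h_disj.
exists (fun b => [set x | A x /\ exists2 m, b m & range (h m) x]) => a b; split.
  move=> ab; have [f [fL fin fout]] := collapse_Lip a ultra rinj cz.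
  exists f => //; apply/seteqP; split=> x /=.
    move=> [Ax [m am Vm]].
    rewrite fout; first by split=> //; exists m => //; exact: ab.
    by move=> n; rewrite (hz m) // => /rinj <-.
  (* On a collapsed sphere the image [c n] lies in no [range (h m)], so it is outside [psi b]. *)
  have [[n an zx]|none] := pselect (exists2 n, ~ a n & mdist z x = r n).
    rewrite (fin n) // => -[_ [m _ Vm]].
    by have := hz _ _ Vm; rewrite cz => /rinj nm; rewrite -nm in Vm; case: (hc n).
  have xa n : mdist z x = r n -> a n.
    by move=> zx; apply: contrapT => an; apply: none; exists n.
  rewrite fout // => -[Ax [m _ Vm]]; split=> //; exists m => //.
  by apply: xa; exact: hz.
move=> [f fB ab] n an; apply: contrapT => bn.
have [j jfn] := taskP f n fB; have := AP j b; rewrite jfn /=.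
apply=> // x Vx.
(* As [n] is in [a], the set [psi a] agrees with [A] on [range (h n)]. *)
have -> : (A (f x) /\ exists2 m, b m & range (h m) (f x)) <->
    (A x /\ exists2 m, a m & range (h m) x).
  by rewrite -[X in X <-> _]/((f @^-1` [set x | A x /\ exists2 m, b m & range (h m) x]) x) -ab.
by split=> [Ax|[]//]; split=> //; exists n.
Qed.

(** * From reductions to the hierarchy of degrees *)

Section Hierarchy.
Variables (X : Type) (F : set (X -> X)).
Hypothesis redF : reducibility F.

Lemma reducible_refl A : reducible F A A.
Proof. by exists id => //; case: redF. Qed.

Lemma reducible_trans B A C :
  reducible F A B -> reducible F B C -> reducible F A C.
Proof.
by move=> [f Ff ->] [g Fg ->]; exists (g \o f) => //; exact: redF.2.
Qed.

Lemma degree_leE A B : degree_le F (degree F A) (degree F B) <-> reducible F A B.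
Proof.
split=> [[A' [B' [[AA' _] [_ B'B] A'B']]]|AB].
  exact: reducible_trans (reducible_trans AA' A'B') B'B.
exists A, B; split=> //; split; exact: reducible_refl.
Qed.

(** Singletons form an infinite antichain for inclusion, and the final segments of [nat] a strictly
    descending chain. *)
Lemma embedding_very_bad (psi : set nat -> set X) :
  (forall a b, reducible F (psi a) (psi b) <-> a `<=` b) ->
  powerset_omega_embeds F /\ very_bad F.
Proof.
move=> psiP; pose g a := degree F (psi a).
have gP a b : degree_le F (g a) (g b) <-> a `<=` b.
  by rewrite degree_leE psiP.
have gH a : hierarchy F (g a) by exists (psi a).
split; first by exists g; split=> // a b; rewrite gP.
split.
  exists (range (fun n => g [set n])); split.
  - by move=> _ [n _ <-].
  - rewrite (eq_finite_set (inj_card_eq _)); first exact: infinite_nat.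
    move=> m n _ _ /= mn; have : degree_le F (g [set m]) (g [set n]).
      by rewrite -mn; apply/gP.
    by move/gP => /(_ m erefl).
  - move=> _ _ [m _ <-] [n _ <-] mn /gP /(_ m erefl) /= emn.
    by apply: mn; rewrite emn.
exists (fun n => g [set m | (n <= m)%N]); split=> // n; split.
  by apply/gP => m /= /ltnW.
by move=> /gP /(_ n (leqnn n)) /=; rewrite ltnn.
Qed.

End Hierarchy.

Theorem theorem6p3 (R : realType) (X : metricType R)
    (polishX : ultrametric_polish X) (uncX : ~ countable [set: X]) :
  (exists psi : set nat -> set X,
     forall a b : set nat,
       (a `<=` b -> reducible (@Lip R X) (psi a) (psi b)) /\
       (reducible (@Bor X) (psi a) (psi b) -> a `<=` b)) /\
  (forall F : set (X -> X),
     reducibility F -> @Lip R X `<=` F -> F `<=` @Bor X ->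
     powerset_omega_embeds F /\ very_bad F).
Proof.
have [psi psiP] := exists_powerset_reduction polishX uncX.
split=> [|F redF LF FB]; first by exists psi.
apply: (embedding_very_bad redF (psi := psi)) => a b; split.
  by move=> [f /FB fB ab]; apply: (psiP a b).2; exists f.
by move=> /(psiP a b).1[f /LF Ff ab]; exists f.
Qed.
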